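(* Let $(\mathfrak{g},\rho,V,\mathcal{V},B_0)$ and $(\mathfrak{g},\pi,U,\mathcal{U},B_0)$ be standard pentads over a field $\mathfrak{k}$ (with the same $\mathfrak{g}$ and $B_0$) and assume that $B_0$ is symmetric. Then the pentad $(L(\mathfrak{g},\rho,V,\mathcal{V},B_0),\tilde\pi^+,\tilde U^+,\tilde{\mathcal{U}}^-,B_L)$ is also a standard pentad, and its $\Phi$-map, denoted $\tilde\Phi^+_\pi$, is given by $$\tilde\Phi^+_\pi(u_i^+\otimes w_{-j}^-)=\tilde\Phi^i_{-j}(u_i^+\otimes w_{-j}^-)$$ for any $i,j\ge0$, $u_i^+\in U_i^+$ and $w_{-j}^-\in\mathcal{U}_{-j}^-$.
   Context: All objects are over a field $\mathfrak{k}$ and may be infinite-dimensional. A representation of a Lie algebra $\mathfrak{l}$ on $W$ is written as a linear map $\mathfrak{l}\otimes W\to W$. Standard pentad $(\mathfrak{g},\rho,V,\mathcal{V},B_0)$: $\mathfrak{g}$ is a non-zero Lie algebra with a non-degenerate invariant bilinear form $B_0$ ($B_0([a,b],c)=B_0(a,[b,c])$), $\rho:\mathfrak{g}\otimes V\to V$ is a representation, $\mathcal{V}$ is a $\mathfrak{g}$-submodule of $\mathrm{Hom}(V,\mathfrak{k})$ with canonical representation $\varrho$ (so $\langle\rho(a\otimes v),\phi\rangle=-\langle v,\varrho(a\otimes\phi)\rangle$ for the canonical pairing $\langle\cdot,\cdot\rangle$), such that (i) $\langle\cdot,\cdot\rangle$ restricted to $V\times\mathcal{V}$ is non-degenerate,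 (ii) there is a (necessarily unique) linear map $\Phi_\rho:V\otimes\mathcal{V}\to\mathfrak{g}$, the $\Phi$-map, with $B_0(a,\Phi_\rho(v\otimes\phi))=\langle\rho(a\otimes v),\phi\rangle$ for all $a,v,\phi$. Put $\Psi_\rho(\phi\otimes v):=-\Phi_\rho(v\otimes\phi)$. A module $\mathcal{V}$ with a non-degenerate invariant pairing $V\times\mathcal{V}\to\mathfrak{k}$ is regarded as a submodule of $\mathrm{Hom}(V,\mathfrak{k})$. Associated graded Lie algebra $L=L(\mathfrak{g},\rho,V,\mathcal{V},B_0)=\bigoplus_{n}V_n$: $V_0:=\mathfrak{g}$, $V_1:=V$, $V_{-1}:=\mathcal{V}$, with canonical representations $\rho_0$ (adjoint), $\rho_1=\rho$, $\rho_{-1}=\varrho$. For $x\in V_1$, $y\in V_{-1}$ write $x(y):=\Phi_\rho(x\otimes y)$, $y(x):=\Psi_\rho(y\otimes x)$. Let $p_0(x\otimes a):=-\rho_1(a\otimes x)$, $q_0(y\otimes a):=-\rho_{-1}(a\otimes y)$ for $a\in V_0$. Define $p_1:V_1\otimes V_1\to\mathrm{Hom}(V_{-1},V_1)$ by $p_1(v\otimes u)(\eta)=\rho_1(v(\eta)\otimes u)-\rho_1(u(\eta)\otimes v)$ and $q_{-1}:V_{-1}\otimes V_{-1}\to\mathrm{Hom}(V_1,V_{-1})$ by $q_{-1}(\phi\otimes\psi)(\xi)=\rho_{-1}(\phi(\xi)\otimes\psi)-\rho_{-1}(\psi(\xi)\otimes\phi)$. For $i\ge2$, inductively, $V_i:=\mathrm{Im}\,p_{i-1}\subset\mathrm{Hom}(V_{-1},V_{i-1})$,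 $V_{-i}:=\mathrm{Im}\,q_{-i+1}\subset\mathrm{Hom}(V_1,V_{-i+1})$ with the canonical $\mathfrak{g}$-module structures $\rho_{i},\rho_{-i}$, and $p_i:V_1\otimes V_i\to\mathrm{Hom}(V_{-1},V_i)$, $p_i(v\otimes u)(\eta)=\rho_i(v(\eta)\otimes u)+p_{i-1}(v\otimes u(\eta))$; $q_{-i}:V_{-1}\otimes V_{-i}\to\mathrm{Hom}(V_1,V_{-i})$, $q_{-i}(\phi\otimes\psi)(\xi)=\rho_{-i}(\phi(\xi)\otimes\psi)+q_{-i+1}(\phi\otimes\psi(\xi))$. The Lie bracket satisfies, for $a\in V_0$, $x\in V_1$, $y\in V_{-1}$, $z_n\in V_n$: $[a,z_n]=\rho_n(a\otimes z_n)$; $[x,z_n]=p_n(x\otimes z_n)$ if $n\ge0$, $=-z_n(x)$ if $n\le-1$; $[y,z_n]=-z_n(y)$ if $n\ge1$, $=q_n(y\otimes z_n)$ if $n\le0$; and it is extended inductively ($i\ge1$) by $[p_i(x\otimes z_i),w]=[x,[z_i,w]]-[z_i,[x,w]]$, $[q_{-i}(y\otimes\omega_{-i}),w]=[y,[\omega_{-i},w]]-[\omega_{-i},[y,w]]$. It is a theorem that this is a well-defined Lie algebra with $[V_n,V_m]\subset V_{n+m}$, generated by $V_{-1}\oplus V_0\oplus V_1$. Form $B_L$ (for symmetric $B_0$): the non-degenerate symmetric invariant bilinear form on $L$ determined by $B_L|_{V_0\times V_0}=B_0$, $B_L(v,\phi)=\langle v,\phi\rangle$ for $v\in V_1,\phi\in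 V_{-1}$, $B_L(p_i(v\otimes u),q_{-i}(\phi\otimes\psi))=B_L(u,[q_{-i}(\phi\otimes\psi),v])$ for $i\ge1$, and $B_L(V_n,V_m)=0$ for $n+m\ne0$. Positive extension $(\tilde\pi^+,\tilde U^+)$ of the $\mathfrak{g}$-module $(\pi,U)$: $U_0^+:=U$, $\pi_0^+:=\pi$, $r_0^+:V_1\otimes U_0^+\to\mathrm{Hom}(V_{-1},U_0^+)$, $r_0^+(x\otimes u)(\eta)=\pi([\eta,x]\otimes u)$; for $j\ge1$, $U_j^+:=\mathrm{Im}\,r_{j-1}^+\subset\mathrm{Hom}(V_{-1},U_{j-1}^+)$ with canonical representation $\pi_j^+$ of $\mathfrak{g}$, and $r_j^+(x\otimes u)(\eta)=\pi_j^+([\eta,x]\otimes u)+r_{j-1}^+(x\otimes u(\eta))$. $\tilde U^+=\bigoplus_{m\ge0}U_m^+$; $\tilde\pi^+$ is the (unique, well-defined) $L$-module structure with $\tilde\pi^+(V_n\otimes U_m^+)\subset U_{n+m}^+$ and, for $u\in U_m^+$: $V_0$ acting by $\pi_m^+$; $x\in V_1$ acting by $u\mapsto r_m^+(x\otimes u)$; $y\in V_{-1}$ acting by $u\mapsto u(y)$ for $m\ge1$ and by $0$ for $m=0$. Negative extension $(\tilde\varpi^-,\tilde{\mathcal{U}}^-)$ of the $\mathfrak{g}$-module $(\varpi,\mathcal{U})$ ($\varpi$ the canonical representation on $\mathcal{U}\subset\mathrm{Hom}(U,\mathfrak{k})$): $\mathcal{U}_0^-:=\mathcal{U}$, $r_0^-:V_{-1}\otimes\mathcal{U}_0^-\to\mathrm{Hom}(V_1,\mathcal{U}_0^-)$,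 $r_0^-(y\otimes w)(\xi)=\varpi([\xi,y]\otimes w)$; for $j\ge1$, $\mathcal{U}_{-j}^-:=\mathrm{Im}\,r_{-j+1}^-\subset\mathrm{Hom}(V_1,\mathcal{U}_{-j+1}^-)$ with canonical representation $\varpi_{-j}^-$, and $r_{-j}^-(y\otimes w)(\xi)=\varpi_{-j}^-([\xi,y]\otimes w)+r_{-j+1}^-(y\otimes w(\xi))$. $\tilde{\mathcal{U}}^-=\bigoplus_{m\le0}\mathcal{U}_m^-$; $\tilde\varpi^-$ is the (unique, well-defined) graded $L$-module structure with, for $w\in\mathcal{U}_m^-$: $V_0$ acting by $\varpi_m^-$; $y\in V_{-1}$ acting by $w\mapsto r_m^-(y\otimes w)$; $x\in V_1$ acting by $w\mapsto w(x)$ for $m\le-1$ and by $0$ for $m=0$. Pairing: $\tilde{\mathcal{U}}^-$ is regarded as an $L$-submodule of $\mathrm{Hom}(\tilde U^+,\mathfrak{k})$ via the (well-defined) bilinear map $\langle\cdot,\cdot\rangle:\tilde U^+\times\tilde{\mathcal{U}}^-\to\mathfrak{k}$ which is zero on $U_n^+\times\mathcal{U}_{-m}^-$ for $n\ne m$, is the canonical pairing on $U_0^+\times\mathcal{U}_0^-=U\times\mathcal{U}$, and for $i\ge1$ satisfies $\langle r_{i-1}^+(x\otimes u),r_{-i+1}^-(y\otimes w)\rangle=-\langle\tilde\pi^+(y\otimes r_{i-1}^+(x\otimes u)),w\rangle$. Maps $\tilde\Phi^i_{-j}:U_i^+\otimes\mathcal{U}_{-j}^-\to V_{i-j}$ ($i,j\ge0$),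 defined inductively (and well-defined): $\tilde\Phi^0_0:=\Phi_\pi$, the $\Phi$-map of $(\mathfrak{g},\pi,U,\mathcal{U},B_0)$; $\tilde\Phi^{i+1}_0(r_i^+(x\otimes u)\otimes w):=[x,\tilde\Phi^i_0(u\otimes w)]$ for $x\in V_1$, $u\in U_i^+$, $w\in\mathcal{U}_0^-$; and for $y\in V_{-1}$, $u\in U_k^+$, $w\in\mathcal{U}_{-j}^-$, $\tilde\Phi^k_{-j-1}(u\otimes r_{-j}^-(y\otimes w)):=[y,\tilde\Phi^0_{-j}(u\otimes w)]$ if $k=0$, and $:=[y,\tilde\Phi^k_{-j}(u\otimes w)]-\tilde\Phi^{k-1}_{-j}(\tilde\pi^+(y\otimes u)\otimes w)$ if $k\ge1$. *)

(* Defs.v *)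
From HB Require Import structures.
From mathcomp Require Import all_boot all_order all_algebra.
From mathcomp Require Import boolp classical_sets functions cardinality.

Set Implicit Arguments.
Unset Strict Implicit.
Unset Printing Implicit Defensive.

Import GRing.Theory.
Local Open Scope ring_scope.

(* A linear map out of a tensor product M (x) N is represented by the
   corresponding bilinear map on M x N. *)

Section DirectSum.
Context (k : fieldType) (I : Type) (F : I -> lmodType k).

Definition dprod : Type := forall i, F i.
HB.instance Definition _ := gen_eqMixin dprod.
HB.instance Definition _ := gen_choiceMixin dprod.

Definition dprod_add (f g : dprod) : dprod := fun i => f i + g i.
Definition dprod_opp (f : dprod) : dprod := fun i => - f i.
Definition dprod_zero : dprod := fun i => 0.
Definition dprod_scale (c : k) (f : dprod) : dprod := fun i => c *: f i.

Fact dprod_addA : associative dprod_add.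
Proof. by move=> f g h; apply: functional_extensionality_dep => i; exact: addrA. Qed.
Fact dprod_addC : commutative dprod_add.
Proof. by move=> f g; apply: functional_extensionality_dep => i; exact: addrC. Qed.
Fact dprod_add0 : left_id dprod_zero dprod_add.
Proof. by move=> f; apply: functional_extensionality_dep => i; exact: add0r. Qed.
Fact dprod_addN : left_inverse dprod_zero dprod_opp dprod_add.
Proof. by move=> f; apply: functional_extensionality_dep => i; exact: addNr. Qed.

HB.instance Definition _ :=
  GRing.isZmodule.Build dprod dprod_addA dprod_addC dprod_add0 dprod_addN.

Fact dprod_scaleA a b f :
  dprod_scale a (dprod_scale b f) = dprod_scale (a * b) f.
Proof. by apply: functional_extensionality_dep => i; exact: scalerA. Qed.
Fact dprod_scale1 : left_id 1 dprod_scale.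
Proof. by move=> f; apply: functional_extensionality_dep => i; exact: scale1r. Qed.
Fact dprod_scaleDr : right_distributive dprod_scale +%R.
Proof. by move=> a f g; apply: functional_extensionality_dep => i; exact: scalerDr. Qed.
Fact dprod_scaleDl f : {morph dprod_scale^~ f : a b / a + b}.
Proof. by move=> a b; apply: functional_extensionality_dep => i; exact: scalerDl. Qed.

HB.instance Definition _ := GRing.Zmodule_isLmodule.Build k dprod
  dprod_scaleA dprod_scale1 dprod_scaleDr dprod_scaleDl.

Definition finsupp : {pred dprod} :=
  fun f => `[< finite_set [set i | f i != 0]%classic >].

Fact finsupp_submod_closed : submod_closed finsupp.
Proof.
split=> [|c f g].
  rewrite unfold_in; apply/asboolP.
  by rewrite (_ : [set _ | _]%classic = set0)//; apply/seteqP; split=> i //= /eqP.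
rewrite !unfold_in => /asboolP ff /asboolP fg; apply/asboolP.
apply: (@sub_finite_set _ _ ([set i | f i != 0] `|` [set i | g i != 0])%classic).
  move=> i /= nz; case: (eqVneq (f i) 0) => [fi0|]; last by left.
  right; apply: contraNN nz => /eqP gi0.
  rewrite (_ : (c *: f + g) i = c *: f i + g i)//.
  by rewrite fi0 gi0 scaler0 addr0.
by rewrite finite_setU.
Qed.

HB.instance Definition _ :=
  GRing.isSubmodClosed.Build k dprod finsupp finsupp_submod_closed.

Record dsum : Type := DSum { dsum_val :> dprod; _ : finsupp dsum_val }.
HB.instance Definition _ := [isSub for dsum_val].
HB.instance Definition _ := [Choice of dsum by <:].
HB.instance Definition _ := [SubChoice_isSubLmodule of dsum by <:].

Definition component (f : dsum) (i : I) : F i := val f i.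

End DirectSum.

Section Inclusion.
Context (k : fieldType) (I : eqType) (F : I -> lmodType k) (i : I).

Fact dfwith_finsupp (z : F i) :
  @finsupp k I F (dfwith (fun j => 0 : F j) z).
Proof.
apply/asboolP; apply: (@sub_finite_set _ _ [set i]%classic) => // j /=.
by case: dfwithP => // ? _ /eqP.
Qed.

Definition inc (z : F i) : dsum F := DSum (dfwith_finsupp z).

End Inclusion.

Definition lie_algebra (k : fieldType) (g : lmodType k)
    (br : {bilinear g -> g -> g}) : Prop :=
  (forall a, br a a = 0) /\
  (forall a b c, br a (br b c) + br b (br c a) + br c (br a b) = 0).

Definition representation (k : fieldType) (g W : lmodType k)
    (br : {bilinear g -> g -> g}) (rho : {bilinear g -> W -> W}) : Prop :=
  forall a b w, rho (br a b) w = rho a (rho b w) - rho b (rho a w).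

Definition nondegenerate (k : fieldType) (U W : lmodType k)
    (b : {bilinear U -> W -> k | *%R & *%R}) : Prop :=
  (forall u, (forall w, b u w = 0) -> u = 0) /\
  (forall w, (forall u, b u w = 0) -> w = 0).

Definition invariant_form (k : fieldType) (g : lmodType k)
    (br : {bilinear g -> g -> g}) (B : {biscalar g}) : Prop :=
  forall a b c, B (br a b) c = B a (br b c).

Definition sym_form (k : fieldType) (g : lmodType k)
    (B : {biscalar g}) : Prop := forall a b, B a b = B b a.

(* The data (g, [.,.], B_0) of a pentad. *)
Record lie_data (k : fieldType) := LieData {
  carrier :> lmodType k;
  bracket : {bilinear carrier -> carrier -> carrier};
  B0 : {biscalar carrier} }.

(* The data (rho, V, VV) of a pentad. The submodule VV of Hom(V, k) is given
   as a module with its pairing with V, which [standard_pentad] requires to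
   be invariant and non-degenerate, so that VV embeds in Hom(V, k). *)
Record paired_modules (k : fieldType) (g : lmodType k) := PairedModules {
  modV : lmodType k;
  rep : {bilinear g -> modV -> modV};
  modVV : lmodType k;
  corep : {bilinear g -> modVV -> modVV};
  pairing : {bilinear modV -> modVV -> k | *%R & *%R} }.

Definition Phi_map (k : fieldType) (G : lie_data k) (D : paired_modules G)
    (Phi : {bilinear modV D -> modVV D -> G}) : Prop :=
  forall a v phi, B0 G a (Phi v phi) = pairing D (rep D a v) phi.

Record standard_pentad (k : fieldType) (G : lie_data k)
    (D : paired_modules G) : Prop := {
  sp_lie : lie_algebra (bracket G);
  sp_nonzero : exists a : G, a != 0;
  sp_form_invariant : invariant_form (bracket G) (B0 G);
  sp_form_nondegenerate : nondegenerate (B0 G);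
  sp_rep : representation (bracket G) (rep D);
  sp_corep : representation (bracket G) (corep D);
  sp_pairing_invariant : forall a v phi,
    pairing D (rep D a v) phi = - pairing D v (corep D a phi);
  sp_pairing_nondegenerate : nondegenerate (pairing D);
  sp_Phi : exists Phi, @Phi_map k G D Phi }.

(* The four inductive constructions V_1, V_2, ...; V_{-1}, V_{-2}, ...;
   U_0^+, U_1^+, ... and UU_0^-, UU_{-1}^-, ... have the same shape: starting
   from a g-module M, given a g-module Y and a space X, level n.+1 is the image
   of a map r_n : X (x) M_n -> Hom(Y, M_n), where r_0 is given and
     r_{n+1}(x (x) u)(y) = c(x,y).u + r_n(x (x) u(y)). *)
Record tower (k : fieldType) (g : lmodType k) := Tower {
  tX : lmodType k;
  tY : lmodType k;
  tM : lmodType k;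
  tactY : g -> tY -> tY;
  tactM : g -> tM -> tM;
  tcross : tX -> tY -> g;
  traise0 : tX -> tM -> tY -> tM }.

Section Tower.
Context (k : fieldType) (g : lmodType k) (T : tower g).

(* Y -> (Y -> ... -> (Y -> M)), with n arguments; the linear maps are not
   singled out here, since the values of r_n(x (x) u) are linear for u in
   level n, so that the image is the same in the space of all functions. *)
Fixpoint homs (n : nat) : lmodType k :=
  if n is m.+1 then ((tY T -> homs m)%type : lmodType k) else tM T.

Fixpoint hom_act (n : nat) : g -> homs n -> homs n :=
  if n is m.+1 return g -> homs n -> homs n then
    fun a f => (fun y => hom_act a (f y) - f (tactY a y))
  else @tactM k g T.

Fixpoint raise (n : nat) : tX T -> homs n -> homs n.+1 :=
  if n is m.+1 return tX T -> homs n -> homs n.+1 then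
    fun x u => (fun y => @hom_act m.+1 (tcross x y) u + raise x (u y))
  else @traise0 k g T.

(* The image of a linear map on X (x) M_n is the span of its values on
   pure tensors. *)
Fixpoint layer_set (n : nat) : set (homs n) :=
  if n is m.+1 return set (homs n) then
    fun f => exists (N : nat) (c : 'I_N -> k) (x : 'I_N -> tX T)
                    (u : 'I_N -> homs m),
      (forall i, layer_set (u i)) /\ f = \sum_i c i *: raise (x i) (u i)
  else setT.

Definition layer_pred (n : nat) : {pred homs n} :=
  fun f => `[< layer_set f >].

Fact layer_submod_closed n : submod_closed (@layer_pred n).
Proof.
case: n => [|n]; first by split=> [|a f h _ _]; exact/asboolP.
split=> [|a f h].
  apply/asboolP; exists 0%N, (fun=> 0), (fun=> 0), (fun=> 0).
  by split=> [[]//|]; rewrite big_ord0.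
move=> /asboolP[N1 [c1 [x1 [u1 [H1 ->]]]]] /asboolP[N2 [c2 [x2 [u2 [H2 ->]]]]].
apply/asboolP; exists (N1 + N2)%N.
exists (fun i => match fintype.split i with inl j => a * c1 j | inr j => c2 j end).
exists (fun i => match fintype.split i with inl j => x1 j | inr j => x2 j end).
exists (fun i => match fintype.split i with inl j => u1 j | inr j => u2 j end).
split; first by move=> i; case: (fintype.split i) => j; [exact: H1|exact: H2].
rewrite big_split_ord /= scaler_sumr; congr (_ + _); apply: eq_bigr => i _.
  by rewrite (unsplitK (inl i)) scalerA.
by rewrite (unsplitK (inr i)).
Qed.

HB.instance Definition _ n :=
  GRing.isSubmodClosed.Build k (homs n) (@layer_pred n) (layer_submod_closed n).

Record layer (n : nat) : Type :=
  Layer { layer_val :> homs n; _ : layer_pred layer_val }.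
HB.instance Definition _ n := [isSub for @layer_val n].
HB.instance Definition _ n := [Choice of layer n by <:].
HB.instance Definition _ n := [SubChoice_isSubLmodule of layer n by <:].

Fact layer_base_subproof (u : tM T) : @layer_pred 0 u.
Proof. exact/asboolP. Qed.
Definition layer_base (u : tM T) : layer 0 := Layer (layer_base_subproof u).

Fact layer_raise_subproof n x (u : layer n) :
  @layer_pred n.+1 (raise x (val u)).
Proof.
apply/asboolP; exists 1%N, (fun=> 1), (fun=> x), (fun=> val u); split.
  by move=> _; apply/asboolP; exact: (valP u).
by rewrite big_ord1 scale1r.
Qed.
Definition layer_raise n x (u : layer n) : layer n.+1 :=
  Layer (layer_raise_subproof x u).

End Tower.

Arguments layer_raise {k g T n}.

(* With c(x,y) = x(y), this is the tower of the V_{i+1} = Im p_i (resp. the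
   V_{-i-1} = Im q_{-i}), whose level 0 is V_1 = V (resp. V_{-1} = VV). *)
Definition lie_tower (k : fieldType) (g X Y : lmodType k)
    (actX : g -> X -> X) (actY : g -> Y -> Y) (c : X -> Y -> g) : tower g :=
  {| tX := X; tY := Y; tM := X; tactY := actY; tactM := actX; tcross := c;
     traise0 := fun v u eta => actX (c v eta) u - actX (c u eta) v |}.

(* With c(x,y) = [y,x], this is the tower of the U_j^+ (resp. UU_{-j}^-). *)
Definition module_tower (k : fieldType) (g X Y M : lmodType k)
    (actY : g -> Y -> Y) (actM : g -> M -> M) (c : X -> Y -> g) : tower g :=
  {| tX := X; tY := Y; tM := M; tactY := actY; tactM := actM; tcross := c;
     traise0 := fun x u eta => actM (c x eta) u |}.

Section AssociatedLie.
Context (k : fieldType) (G : lie_data k) (D : paired_modules G).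
Context (Phi : {bilinear modV D -> modVV D -> G}).

Local Notation V := (modV D).
Local Notation VV := (modVV D).

Definition Psi (y : VV) (x : V) : G := - Phi x y.

Definition pos_tower : tower G := lie_tower (rep D) (corep D) Phi.
Definition neg_tower : tower G := lie_tower (corep D) (rep D) Psi.

Definition Lpiece (n : int) : lmodType k :=
  match n with
  | Posz 0 => G
  | Posz i.+1 => layer pos_tower i
  | Negz i => layer neg_tower i
  end.

Definition L : lmodType k := dsum Lpiece.

(* [inP i] and [prP i] concern V_{i+1}; [inN i] and [prN i] concern V_{-i-1}. *)
Definition inG (a : G) : L := @inc k int Lpiece (Posz 0) a.
Definition inP i (z : layer pos_tower i) : L := @inc k int Lpiece (Posz i.+1) z.
Definition inN i (z : layer neg_tower i) : L := @inc k int Lpiece (Negz i) z.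
Definition inX (x : V) : L := @inP 0 (@layer_base k G pos_tower x).
Definition inY (y : VV) : L := @inN 0 (@layer_base k G neg_tower y).
Definition prP i (z : L) : layer pos_tower i := @component k int Lpiece z (Posz i.+1).
Definition prN i (z : L) : layer neg_tower i := @component k int Lpiece z (Negz i).

(* p_{i+1} and q_{-i-1} *)
Definition pP i (x : V) (z : layer pos_tower i) : layer pos_tower i.+1 :=
  @layer_raise k G pos_tower i x z.
Definition qN i (y : VV) (z : layer neg_tower i) : layer neg_tower i.+1 :=
  @layer_raise k G neg_tower i y z.

(* The Lie bracket of L is the unique bilinear map with this property. When
   the value of a bracket is an element of a Hom-space not known by its type to
   lie in the image defining V_n, the equation is stated on the component of
   degree n, in the Hom-space; the other components vanish by [ab_graded]. *)
Record assoc_bracket (br : {bilinear L -> L -> L}) : Prop := {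
  ab_lie : lie_algebra br;
  ab_graded : forall (n m l : int) (z : Lpiece n) (w : Lpiece m),
    l != n + m -> component (br (inc z) (inc w)) l = 0;
  ab_GG : forall a b, br (inG a) (inG b) = inG (bracket G a b);
  ab_GP : forall a i (z : layer pos_tower i),
    val (prP i (br (inG a) (inP z))) = hom_act a (val z);
  ab_GN : forall a i (z : layer neg_tower i),
    val (prN i (br (inG a) (inN z))) = hom_act a (val z);
  ab_XG : forall x a, br (inX x) (inG a) = inX (- rep D a x);
  ab_XP : forall x i (z : layer pos_tower i),
    br (inX x) (inP z) = inP (pP x z);
  ab_XY : forall x y, br (inX x) (inY y) = inG (- Psi y x);
  ab_XN : forall x i (z : layer neg_tower i.+1),
    val (prN i (br (inX x) (inN z))) = - (val z x);
  ab_YG : forall y a, br (inY y) (inG a) = inY (- corep D a y);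
  ab_YN : forall y i (z : layer neg_tower i),
    br (inY y) (inN z) = inN (qN y z);
  ab_YX : forall y x, br (inY y) (inX x) = inG (- Phi x y);
  ab_YP : forall y i (z : layer pos_tower i.+1),
    val (prP i (br (inY y) (inP z))) = - (val z y);
  ab_extP : forall x i (z : layer pos_tower i) w,
    br (inP (pP x z)) w =
    br (inX x) (br (inP z) w) - br (inP z) (br (inX x) w);
  ab_extN : forall y i (z : layer neg_tower i) w,
    br (inN (qN y z)) w =
    br (inY y) (br (inN z) w) - br (inN z) (br (inY y) w) }.

Record assoc_form (br : {bilinear L -> L -> L}) (B : {biscalar L}) : Prop := {
  af_symmetric : sym_form B;
  af_nondegenerate : nondegenerate B;
  af_invariant : invariant_form br B;
  af_GG : forall a b, B (inG a) (inG b) = B0 G a b;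
  af_XY : forall v phi, B (inX v) (inY phi) = pairing D v phi;
  af_PN : forall i v (u : layer pos_tower i) phi (psi : layer neg_tower i),
    B (inP (pP v u)) (inN (qN phi psi)) =
    B (inP u) (br (inN (qN phi psi)) (inX v));
  af_zero : forall (n m : int) (z : Lpiece n) (w : Lpiece m),
    n + m != 0 -> B (inc z) (inc w) = 0 }.

Context (E : paired_modules G).

(* In L, [eta, x] = - Phi x eta and [xi, y] = Phi xi y for x, xi in V and
   eta, y in VV. *)
Definition ext_pos_tower : tower G :=
  @module_tower k G V VV (modV E) (corep D) (rep E) (fun x eta => - Phi x eta).
Definition ext_neg_tower : tower G :=
  @module_tower k G VV V (modVV E) (rep D) (corep E) (fun y xi => Phi xi y).

Definition Upos_piece (m : nat) : lmodType k := layer ext_pos_tower m.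
(* [Uneg_piece j] is UU_{-j}^-. *)
Definition Uneg_piece (j : nat) : lmodType k := layer ext_neg_tower j.

Definition Upos : lmodType k := dsum Upos_piece.
Definition Uneg : lmodType k := dsum Uneg_piece.

Definition incU m (u : layer ext_pos_tower m) : Upos :=
  @inc k nat Upos_piece m u.
Definition incUU m (w : layer ext_neg_tower m) : Uneg :=
  @inc k nat Uneg_piece m w.
Definition prU m (u : Upos) : layer ext_pos_tower m :=
  @component k nat Upos_piece u m.
Definition prUU m (w : Uneg) : layer ext_neg_tower m :=
  @component k nat Uneg_piece w m.

(* r_m^+ and r_{-m}^- *)
Definition rpos m (x : V) (u : layer ext_pos_tower m) :
  layer ext_pos_tower m.+1 := @layer_raise k G ext_pos_tower m x u.
Definition rneg m (y : VV) (w : layer ext_neg_tower m) :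
  layer ext_neg_tower m.+1 := @layer_raise k G ext_neg_tower m y w.

Record positive_extension (br : {bilinear L -> L -> L})
    (act : {bilinear L -> Upos -> Upos}) : Prop := {
  pe_rep : representation br act;
  pe_graded : forall (n : int) (m l : nat) (z : Lpiece n)
      (u : layer ext_pos_tower m),
    Posz l != n + Posz m -> prU l (act (inc z) (incU u)) = 0;
  pe_G : forall a m (u : layer ext_pos_tower m),
    val (prU m (act (inG a) (incU u))) = hom_act a (val u);
  pe_X : forall x m (u : layer ext_pos_tower m),
    act (inX x) (incU u) = incU (rpos x u);
  pe_Y : forall y m (u : layer ext_pos_tower m.+1),
    val (prU m (act (inY y) (incU u))) = val u y;
  pe_Y0 : forall y (u : layer ext_pos_tower 0), act (inY y) (incU u) = 0 }.

Record negative_extension (br : {bilinear L -> L -> L})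
    (act : {bilinear L -> Uneg -> Uneg}) : Prop := {
  ne_rep : representation br act;
  ne_graded : forall (n : int) (m l : nat) (z : Lpiece n)
      (w : layer ext_neg_tower m),
    - Posz l != n - Posz m -> prUU l (act (inc z) (incUU w)) = 0;
  ne_G : forall a m (w : layer ext_neg_tower m),
    val (prUU m (act (inG a) (incUU w))) = hom_act a (val w);
  ne_Y : forall y m (w : layer ext_neg_tower m),
    act (inY y) (incUU w) = incUU (rneg y w);
  ne_X : forall x m (w : layer ext_neg_tower m.+1),
    val (prUU m (act (inX x) (incUU w))) = val w x;
  ne_X0 : forall x (w : layer ext_neg_tower 0), act (inX x) (incUU w) = 0 }.

Record extension_pairing (act : {bilinear L -> Upos -> Upos})
    (pr : {bilinear Upos -> Uneg -> k | *%R & *%R}) : Prop := {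
  ep_zero : forall n m (u : layer ext_pos_tower n) (w : layer ext_neg_tower m),
    n != m -> pr (incU u) (incUU w) = 0;
  ep_base : forall u w,
    pr (@incU 0 (@layer_base k G ext_pos_tower u))
       (@incUU 0 (@layer_base k G ext_neg_tower w)) = pairing E u w;
  ep_raise : forall i x (u : layer ext_pos_tower i)
      y (w : layer ext_neg_tower i),
    pr (incU (rpos x u)) (incUU (rneg y w)) =
    - pr (act (inY y) (incU (rpos x u))) (incUU w) }.

Definition Phi_tilde_family : Type := forall i j : nat,
  {bilinear Upos_piece i -> Uneg_piece j -> Lpiece (Posz i - Posz j)}.

(* The equations are stated in L, after inclusion of the graded pieces, as
   the two sides lie in V_n for propositionally equal degrees n. In [pt_neg],
   y acts on u with values in U_i^+. *)
Record Phi_tilde (Phi_pi : {bilinear modV E -> modVV E -> G})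
    (br : {bilinear L -> L -> L}) (act : {bilinear L -> Upos -> Upos})
    (F : Phi_tilde_family) : Prop := {
  pt_00 : forall u w,
    inc (F 0%N 0%N (@layer_base k G ext_pos_tower u)
                   (@layer_base k G ext_neg_tower w)) = inG (Phi_pi u w);
  pt_pos : forall i x (u : layer ext_pos_tower i) (w : layer ext_neg_tower 0),
    inc (F i.+1 0%N (rpos x u) w) = br (inX x) (inc (F i 0%N u w));
  pt_neg0 : forall j y (u : layer ext_pos_tower 0) (w : layer ext_neg_tower j),
    inc (F 0%N j.+1 u (rneg y w)) = br (inY y) (inc (F 0%N j u w));
  pt_neg : forall i j y (u : layer ext_pos_tower i.+1)
      (w : layer ext_neg_tower j),
    inc (F i.+1 j.+1 u (rneg y w)) =
    br (inY y) (inc (F i.+1 j u w)) -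
    inc (F i j (prU i (act (inY y) (incU u))) w) }.

End AssociatedLie.

(* Main.v *)
Require Import Defs.
From HB Require Import structures.
From mathcomp Require Import all_boot all_order all_algebra.
From mathcomp Require Import boolp classical_sets cardinality.

(* [L] is generated by its parts of degree -1, 0, 1, and the negative extension
   is generated from degree 0 by the action of V_{-1}, so the invariance of the
   pairing follows by induction from its defining recursion; non-degeneracy then
   propagates upwards, an element of positive degree being determined by its
   images under V_{-1} (resp. V_1).
   By invariance of the pairing and of B_L, if t represents
   a |-> <a.u, w>, i.e. B_L(a, t) = <a.u, w> for all a, and t' represents
   a |-> <a.u, z.w>, then [z, t] - t' represents a |-> <a.(z.u), w>. Starting
   from Phi_pi in degree (0, 0), this makes every such functional representable.
   The resulting Phi-map is equivariant, and the recursion for Phi-tilde is the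
   equivariance for z in V_1 and V_{-1}. *)

Import GRing.Theory.
Local Open Scope ring_scope.

Set Implicit Arguments.
Unset Strict Implicit.

(** * Induction principles for direct sums and tower layers *)

Definition lin_closed (k : fieldType) (W : lmodType k) (P : W -> Prop) : Prop :=
  P 0 /\ forall c x y, P x -> P y -> P (c *: x + y).

Lemma lin_closed_sum (k : fieldType) (W : lmodType k) (P : W -> Prop)
    (J : Type) (r : seq J) (c : J -> k) (F : J -> W) :
  lin_closed P -> (forall i, P (F i)) -> P (\sum_(i <- r) c i *: F i).
Proof.
move=> [P0 PD] PF; elim: r => [|i r IH]; first by rewrite big_nil.
by rewrite big_cons; apply: PD.
Qed.

(** Lets an induction on one variable keep the other variables universally quantified. *)
Lemma lin_closed_forall (k : fieldType) (W : lmodType k) (J : Type)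
    (P : J -> W -> Prop) :
  (forall j, lin_closed (P j)) -> lin_closed (fun x => forall j, P j x).
Proof.
move=> clP; split=> [j|c x y Px Py j]; have [P0 PD] := clP j; first exact: P0.
exact: PD.
Qed.

Definition bilinear_pack (k : fieldType) (U W Z : lmodType k) (f : U -> W -> Z)
    (fP : bilinear_for *:%R *:%R f) : {bilinear U -> W -> Z} :=
  HB.pack f (bilinear_isBilinear.Build k U W Z *:%R *:%R f fP).

Section DirectSums.
Context (k : fieldType) (I : eqType) (F : I -> lmodType k).
Implicit Types f g : dsum F.

Lemma component_linear i : linear (fun f => component f i).
Proof. by []. Qed.

Lemma component_sum (J : Type) (r : seq J) (f : J -> dsum F) i :
  component (\sum_(j <- r) f j) i = \sum_(j <- r) component (f j) i.
Proof.
elim: r => [|j r IH]; first by rewrite !big_nil.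
by rewrite !big_cons -IH.
Qed.

Lemma component_inc i (z : F i) : component (inc z) i = z.
Proof. exact: dfwith_in. Qed.

Lemma component_inc_neq i j (z : F i) : i != j -> component (inc z) j = 0.
Proof. exact: dfwith_out. Qed.

Lemma dsum_ext f g : (forall i, component f i = component g i) -> f = g.
Proof. by move=> fg; apply: val_inj; apply: functional_extensionality_dep. Qed.

Lemma inc_linear i : linear (@inc k I F i).
Proof.
move=> c x y; apply: dsum_ext => j.
rewrite component_linear; case: (eqVneq i j) => [ij|neq].
  by case: j / ij; rewrite !component_inc.
by rewrite !component_inc_neq// scaler0 addr0.
Qed.

Lemma inc0 i : @inc k I F i 0 = 0.
Proof. by have := inc_linear (-1) (0 : F i) 0; rewrite scaler0 addr0 scaleN1r addNr. Qed.

Lemma dsum_homogeneous f i :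
  (forall j, j != i -> component f j = 0) -> f = inc (component f i).
Proof.
move=> f0; apply: dsum_ext => j; case: (eqVneq i j) => [ij|neq].
  by case: j / ij; rewrite component_inc.
by rewrite component_inc_neq// f0// eq_sym.
Qed.

(** The support is finite, so a sequence lists it; [undup] makes each component count once. *)
Lemma dsum_decomposition f :
  exists s : seq I, f = \sum_(i <- s) inc (component f i).
Proof.
have : finsupp (dsum_val f) by case: f.
move=> /asboolP /finite_seqP[s sE].
exists (undup s); apply: dsum_ext => i; rewrite component_sum.
case: (boolP (i \in undup s)) => si.
  rewrite (bigD1_seq i)//= ?undup_uniq// component_inc big1 ?addr0// => j ji.
  by rewrite component_inc_neq.
rewrite big_seq big1 => [|j sj].
  apply/eqP; apply: contraNT si => fi0; rewrite mem_undup.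
  by have : [set` s]%classic i by rewrite -sE.
by rewrite component_inc_neq//; apply: contraNneq si => <-.
Qed.

Lemma dsum_ind (P : dsum F -> Prop) : lin_closed P ->
  (forall i (z : F i), P (inc z)) -> forall f, P f.
Proof.
move=> clP Pinc f; have [s ->] := dsum_decomposition f.
under eq_bigr => i _ do rewrite -[inc _]scale1r.
exact: lin_closed_sum.
Qed.
End DirectSums.

(** A layer above level 0 is by definition the span of the raised elements. The spanning family
    lives in the ambient Hom-space, so its members are first repackaged as elements of
    [layer T n]. *)
Lemma layer_ind (k : fieldType) (g : lmodType k) (T : tower g) n
    (P : layer T n.+1 -> Prop) : lin_closed P ->
  (forall x (u : layer T n), P (layer_raise x u)) -> forall u, P u.
Proof.
move=> clP Praise u.
have /asboolP[N [c [x [v [vP uE]]]]] : layer_pred (layer_val u) by case: u.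
have vP' i : layer_pred (v i) by apply/asboolP; exact: vP.
suff -> : u = \sum_i c i *: layer_raise (x i) (Layer (vP' i)).
  exact: lin_closed_sum.
apply: val_inj; rewrite raddf_sum [LHS]uE.
by apply: eq_bigr => i _.
Qed.

Lemma lin_closed_inc (k : fieldType) (I : eqType) (F : I -> lmodType k)
    (P : dsum F -> Prop) i :
  lin_closed P -> lin_closed (fun z : F i => P (inc z)).
Proof.
by move=> [P0 PD]; split=> [|c x y Px Py]; rewrite ?inc0 ?inc_linear//; apply: PD.
Qed.

Lemma layer_base_val (k : fieldType) (g : lmodType k) (T : tower g)
  (u : layer T 0) : u = layer_base (layer_val u).
Proof. exact: val_inj. Qed.

Lemma layers_ind (k : fieldType) (g : lmodType k) (T : tower g)
    (F : nat -> lmodType k := fun n => layer T n) (P : dsum F -> Prop) :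
  lin_closed P ->
  (forall u : layer T 0, P (@inc k nat F 0%N u)) ->
  (forall n x (u : layer T n), P (@inc k nat F n u) ->
     P (@inc k nat F n.+1 (layer_raise x u))) ->
  forall u, P u.
Proof.
move=> clP P0 Praise; apply: dsum_ind => // n.
elim: n => [|n IH] z; first exact: P0.
move: z; apply: layer_ind; first exact: (@lin_closed_inc _ _ F P n.+1 clP).
by move=> x u; apply: Praise; apply: IH.
Qed.

(** Serves predicates that are equations linear in the variable, such as [pair (pi_pos z u) w = -
    pair u (varpi_neg z w)]. *)
Ltac lin_closed_eq :=
  split=> [|? ? ? + +];
  rewrite ?(linear0l, linear0r, linearPl, linearPr) ?oppr0 ?addr0 ?add0r ?subrr //=;
  try by move=> -> ->; rewrite ?opprD -?mulrN -?scalerN ?mulr0 ?scaler0 ?addr0.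

(** * Induction on the Lie algebra and on the two extensions *)

Section Extension.
Context (k : fieldType) (G : lie_data k) (D E : paired_modules G).
Context (Phi_rho : {bilinear modV D -> modVV D -> G}).
Context (br : {bilinear L Phi_rho -> L Phi_rho -> L Phi_rho}).
Context (brP : assoc_bracket br).
Context (pi_pos : {bilinear L Phi_rho -> Upos Phi_rho E -> Upos Phi_rho E}).
Context (pi_posP : positive_extension br pi_pos).
Context (varpi_neg : {bilinear L Phi_rho -> Uneg Phi_rho E -> Uneg Phi_rho E}).
Context (varpi_negP : negative_extension br varpi_neg).
Context (pair : {bilinear Upos Phi_rho E -> Uneg Phi_rho E -> k | *%R & *%R}).
Context (pairP : extension_pairing pi_pos pair).
Context (pentad_pi : standard_pentad E).

Local Notation X := (@inX k G D Phi_rho).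
Local Notation Y := (@inY k G D Phi_rho).
Local Notation IG := (@inG k G D Phi_rho).

(** This is generation of L by degrees -1, 0, 1: each further layer is spanned by values of [pP] or
    [qN], and these are brackets with V_1 or V_{-1}. *)
Lemma L_ind (P : L Phi_rho -> Prop) : lin_closed P ->
  (forall a, P (IG a)) -> (forall x, P (X x)) -> (forall y, P (Y y)) ->
  (forall x z, P z -> P (br (X x) z)) ->
  (forall y z, P z -> P (br (Y y) z)) -> forall z, P z.
Proof.
move=> clP PG PX PY PbX PbY; apply: dsum_ind => // -[[|n]|n].
- exact: PG.
- elim: n => [|n IH] z; first by rewrite (layer_base_val z); exact: PX.
  move: z; apply: layer_ind; 
    first exact: (@lin_closed_inc _ _ (Lpiece Phi_rho) P (Posz n.+2) clP).
  by move=> x u; have := PbX x _ (IH u); rewrite -/(inP u) (ab_XP brP).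
- elim: n => [|n IH] z; first by rewrite (layer_base_val z); exact: PY.
  move: z; apply: layer_ind; 
    first exact: (@lin_closed_inc _ _ (Lpiece Phi_rho) P (Negz n.+1) clP).
  by move=> y u; have := PbY y _ (IH u); rewrite -/(inN u) (ab_YN brP).
Qed.

Lemma Upos_ind (P : Upos Phi_rho E -> Prop) : lin_closed P ->
  (forall u : layer (ext_pos_tower Phi_rho E) 0, P (incU u)) ->
  (forall n x (u : layer (ext_pos_tower Phi_rho E) n), P (incU u) ->
     P (incU (rpos x u))) ->
  forall u, P u.
Proof. exact: layers_ind. Qed.

Lemma Uneg_ind (P : Uneg Phi_rho E -> Prop) : lin_closed P ->
  (forall w : layer (ext_neg_tower Phi_rho E) 0, P (incUU w)) ->
  (forall n y (w : layer (ext_neg_tower Phi_rho E) n), P (incUU w) ->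
     P (incUU (rneg y w))) ->
  forall w, P w.
Proof. exact: layers_ind. Qed.

Lemma pi_Y_homogeneous y m (u : layer (ext_pos_tower Phi_rho E) m.+1) :
  pi_pos (Y y) (incU u) = incU (prU m (pi_pos (Y y) (incU u))).
Proof.
apply: dsum_homogeneous => l lm; apply: (pe_graded pi_posP).
(* [Y y] has degree [Negz 0], that is -1, and -1 + (m + 1) = m. *)
by rewrite NegzE (intS m) addKr.
Qed.

(** * Invariance of the pairing *)

Definition skew_adjoint z : Prop :=
  forall u w, pair (pi_pos z u) w = - pair u (varpi_neg z w).

(** For raised [u] and [w] of matching degree this is the recursion defining the pairing; in all
    other cases both sides vanish, by degree or because V_{-1} kills degree 0. *)
Lemma pair_Y y : skew_adjoint (Y y).
Proof.
move=> u w.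
elim/dsum_ind: w => [|m w]; first by lin_closed_eq.
rewrite -/(incUU w) (ne_Y varpi_negP).
elim/Upos_ind: u => [|u|n x u _]; first by lin_closed_eq.
  by rewrite (pe_Y0 pi_posP) linear0l (ep_zero pairP) ?oppr0.
case: (eqVneq n m) => [nm|nm].
  by case: m / nm w => w; rewrite (ep_raise pairP) opprK.
rewrite pi_Y_homogeneous !(ep_zero pairP) ?oppr0//.
Qed.

(** V_1 maps into positive degrees, which are orthogonal to degree 0. *)
Lemma pair_X_base x u (w : layer (ext_neg_tower Phi_rho E) 0) :
  pair (pi_pos (X x) u) (incUU w) = 0.
Proof.
elim/dsum_ind: u => [|m u]; first by lin_closed_eq.
by rewrite -/(incU u) (pe_X pi_posP) (ep_zero pairP).
Qed.

Lemma varpi_G_homogeneous a m (w : layer (ext_neg_tower Phi_rho E) m) :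
  varpi_neg (IG a) (incUU w) = incUU (prUU m (varpi_neg (IG a) (incUU w))).
Proof.
apply: dsum_homogeneous => l lm; apply: (ne_graded varpi_negP).
by rewrite add0r eqr_opp.
Qed.

Lemma pi_G_homogeneous a m (u : layer (ext_pos_tower Phi_rho E) m) :
  pi_pos (IG a) (incU u) = incU (prU m (pi_pos (IG a) (incU u))).
Proof.
apply: dsum_homogeneous => l lm; apply: (pe_graded pi_posP).
by rewrite add0r.
Qed.

Lemma pi_G_base a u :
  pi_pos (IG a) (incU (@layer_base _ _ (ext_pos_tower Phi_rho E) u)) =
  incU (@layer_base _ _ (ext_pos_tower Phi_rho E) (rep E a u)).
Proof.
rewrite pi_G_homogeneous; congr incU.
by apply: val_inj; rewrite (pe_G pi_posP).
Qed.

Lemma varpi_G_base a w :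
  varpi_neg (IG a) (incUU (@layer_base _ _ (ext_neg_tower Phi_rho E) w)) =
  incUU (@layer_base _ _ (ext_neg_tower Phi_rho E) (corep E a w)).
Proof.
rewrite varpi_G_homogeneous; congr incUU.
by apply: val_inj; rewrite (ne_G varpi_negP).
Qed.

Lemma br_anti a b : br a b = - br b a.
Proof.
have [alt _] := ab_lie brP; apply/eqP; rewrite -addr_eq0.
by have := alt (a + b); rewrite linearDl/= !linearDr/= !alt add0r addr0 => ->.
Qed.

Lemma pi_br a b u :
  pi_pos (br a b) u = pi_pos a (pi_pos b u) - pi_pos b (pi_pos a u).
Proof. exact: pe_rep pi_posP a b u. Qed.

Lemma varpi_br a b w :
  varpi_neg (br a b) w = varpi_neg a (varpi_neg b w) - varpi_neg b (varpi_neg a w).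
Proof. exact: ne_rep varpi_negP a b w. Qed.

Lemma pi_comm a b u : pi_pos a (pi_pos b u) = pi_pos b (pi_pos a u) + pi_pos (br a b) u.
Proof. by rewrite (pe_rep pi_posP) addrC subrK. Qed.

Lemma varpi_comm a b u :
  varpi_neg a (varpi_neg b u) = varpi_neg b (varpi_neg a u) + varpi_neg (br a b) u.
Proof. by rewrite (ne_rep varpi_negP) addrC subrK. Qed.

(** The induction step on the degree of [w]: y is moved to the left by [pair_Y], z is commuted past
    it, and the commutator term is absorbed by the skew-adjointness of [br z (Y y)]. *)
Lemma pair_Y_step z y w :
  skew_adjoint (br z (Y y)) ->
  (forall u, pair (pi_pos z u) w = - pair u (varpi_neg z w)) ->
  forall u, pair (pi_pos z u) (varpi_neg (Y y) w) =
            - pair u (varpi_neg z (varpi_neg (Y y) w)).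
Proof.
move=> inv IH u.
have pairY v w' : pair v (varpi_neg (Y y) w') = - pair (pi_pos (Y y) v) w'.
  by rewrite pair_Y opprK.
rewrite varpi_comm linearDr/= !pairY (pi_comm (Y y)) linearDl/= IH.
by rewrite (br_anti (Y y)) !linearNl/= inv opprK.
Qed.

Lemma pair_G a : skew_adjoint (IG a).
Proof.
move=> u w; elim/Uneg_ind: w u => [|w u|n y w IH u].
- by apply: lin_closed_forall => u; lin_closed_eq.
- elim/Upos_ind: u => [|u|m x u _]; first by lin_closed_eq.
    rewrite (layer_base_val u) (layer_base_val w) pi_G_base varpi_G_base.
    by rewrite !(ep_base pairP) (sp_pairing_invariant pentad_pi).
  (* For raised [u] and [w] of degree 0 both sides vanish: a.(x.u) = x.(a.u) + [a,x].u with [a,x] in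
     V_1, and a.w stays in degree 0. *)
  rewrite -(pe_X pi_posP) pi_comm linearDl/= pair_X_base (br_anti (IG a)).
  rewrite (ab_XG brP) linearNl linearNl pair_X_base add0r oppr0.
  by rewrite varpi_G_homogeneous pair_X_base oppr0.
- rewrite -(ne_Y varpi_negP); apply: pair_Y_step => // v w'.
  by rewrite br_anti (ab_YG brP) !linearNl/= linearNr/= pair_Y.
Qed.

(** Comes after [pair_G] because the step needs skew-adjointness of [x,y], an element of degree
    0. *)
Lemma pair_X x : skew_adjoint (X x).
Proof.
move=> u w; elim/Uneg_ind: w u => [|w u|n y w IH u].
- by apply: lin_closed_forall => u; lin_closed_eq.
- by rewrite pair_X_base (ne_X0 varpi_negP) linear0r oppr0.
- rewrite -(ne_Y varpi_negP); apply: pair_Y_step => // v w'.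
  by rewrite (ab_XY brP) pair_G.
Qed.

Lemma skew_adjoint_br a b : skew_adjoint a -> skew_adjoint b -> skew_adjoint (br a b).
Proof.
move=> inva invb u w; rewrite pi_br varpi_br.
by rewrite linearBl linearBr/= !(inva, invb) !opprK opprB.
Qed.

(** Skew-adjoint elements form a subalgebra containing the generators of L. *)
Lemma pair_invariant z : skew_adjoint z.
Proof.
elim/L_ind: z => [|a|x|y|x z|y z].
- by apply: lin_closed_forall => u; apply: lin_closed_forall => w; lin_closed_eq.
- exact: pair_G.
- exact: pair_X.
- exact: pair_Y.
- by apply: skew_adjoint_br; exact: pair_X.
- by apply: skew_adjoint_br; exact: pair_Y.
Qed.

(** * Non-degeneracy of the pairing *)

Lemma pair_component_l n u (w : layer (ext_neg_tower Phi_rho E) n) :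
  pair u (incUU w) = pair (incU (prU n u)) (incUU w).
Proof.
elim/dsum_ind: u => [|m u].
  split=> [|c u v]; first by rewrite /incU /prU inc0.
  by rewrite /incU /prU component_linear inc_linear !linearPl/= => -> ->.
rewrite -/(incU u); case: (eqVneq m n) => [mn|mn].
  by case: n / mn w => w; rewrite /prU /incU component_inc.
by rewrite (ep_zero pairP)// /prU component_inc_neq// /incU inc0 linear0l.
Qed.

Lemma pair_component_r n (u : layer (ext_pos_tower Phi_rho E) n) w :
  pair (incU u) w = pair (incU u) (incUU (prUU n w)).
Proof.
elim/dsum_ind: w => [|m w].
  split=> [|c w v]; first by rewrite /incUU /prUU inc0.
  by rewrite /incUU /prUU component_linear inc_linear !linearPr/= => -> ->.
rewrite -/(incUU w); case: (eqVneq n m) => [mn|mn].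
  by case: m / mn w => w; rewrite /prUU /incUU component_inc.
rewrite (ep_zero pairP)// /prUU component_inc_neq 1?eq_sym//.
by rewrite /incUU inc0 linear0r.
Qed.

(** In degree n + 1, [u] is a function on V_{-1} with u(y) = y.u. Invariance gives <y.u, w> = -<u,
    y.w> = 0, so each value vanishes by induction. *)
Lemma pair_layer_nondegenerate_l n (u : layer (ext_pos_tower Phi_rho E) n) :
  (forall w : layer (ext_neg_tower Phi_rho E) n, pair (incU u) (incUU w) = 0) ->
  u = 0.
Proof.
elim: n u => [|n IH] u u0.
  apply: val_inj; have [+ _] := sp_pairing_nondegenerate pentad_pi; apply=> w.
  by rewrite -(ep_base pairP) -layer_base_val.
apply: val_inj; apply: functional_extensionality_dep => y.
rewrite -(pe_Y pi_posP) [prU _ _]IH// => w.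
by rewrite -pair_component_l pair_invariant (ne_Y varpi_negP) u0 oppr0.
Qed.

Lemma pair_layer_nondegenerate_r n (w : layer (ext_neg_tower Phi_rho E) n) :
  (forall u : layer (ext_pos_tower Phi_rho E) n, pair (incU u) (incUU w) = 0) ->
  w = 0.
Proof.
elim: n w => [|n IH] w w0.
  apply: val_inj; have [_] := sp_pairing_nondegenerate pentad_pi; apply=> u.
  by rewrite -(ep_base pairP) -layer_base_val.
apply: val_inj; apply: functional_extensionality_dep => x.
rewrite -(ne_X varpi_negP) [prUU _ _]IH// => u.
rewrite -pair_component_r -[LHS]opprK -pair_invariant (pe_X pi_posP).
by rewrite w0 oppr0.
Qed.

Lemma pair_nondegenerate : Defs.nondegenerate pair.
Proof.
split=> [u u0|w w0]; apply: dsum_ext => n.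
  by apply: pair_layer_nondegenerate_l => w; rewrite -pair_component_l.
by apply: pair_layer_nondegenerate_r => u; rewrite -pair_component_r.
Qed.

(** * Representing elements and existence of the Phi-map *)

Context (BL : {biscalar L Phi_rho}) (BLP : assoc_form br BL).
Context (Phi_pi : {bilinear modV E -> modVV E -> G}) (Phi_piP : Phi_map Phi_pi).

(** The graph of the future Phi-map, kept as a relation so that existence can be proved by induction
    before any choice is made. *)
Definition represents u w t : Prop := forall a, BL a t = pair (pi_pos a u) w.

Lemma represents_unique u w t t' :
  represents u w t -> represents u w t' -> t = t'.
Proof.
move=> ut ut'; apply/eqP; rewrite -subr_eq0; apply/eqP.
have [_] := af_nondegenerate BLP; apply=> a.
by rewrite linearBr/= ut ut' subrr.
Qed.

Lemma represents_linear_l c u u' w t t' :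
  represents u w t -> represents u' w t' ->
  represents (c *: u + u') w (c *: t + t').
Proof.
move=> ut ut' a.
by rewrite !linearPr/= linearPl/= ut ut'.
Qed.

Lemma represents_linear_r c u w w' t t' :
  represents u w t -> represents u w' t' ->
  represents u (c *: w + w') (c *: t + t').
Proof. by move=> ut ut' a; rewrite !linearPr/= ut ut'. Qed.

(** In a.(z.u) = z.(a.u) + [a,z].u the first term gives -<a.u, z.w> = -B_L(a,t'), the second
    B_L([a,z],t) = B_L(a,[z,t]). *)
Lemma represents_act_l z u w t t' :
  represents u w t -> represents u (varpi_neg z w) t' ->
  represents (pi_pos z u) w (br z t - t').
Proof.
move=> ut ut' a; rewrite pi_comm linearDl/= (pair_invariant z) -ut' -ut.
by rewrite linearBr/= (af_invariant BLP) addrC.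
Qed.

Lemma represents_act_r z u w t t' :
  represents u w t -> represents (pi_pos z u) w t' ->
  represents u (varpi_neg z w) (br z t - t').
Proof.
move=> ut ut' a; rewrite -[RHS]opprK -pair_invariant pi_comm linearDl/=.
rewrite opprD -ut' (br_anti z a) !linearNl/= -ut opprK.
by rewrite linearBr/= (af_invariant BLP) addrC.
Qed.

Lemma represents_base u w :
  represents (incU (@layer_base _ _ (ext_pos_tower Phi_rho E) u))
    (incUU (@layer_base _ _ (ext_neg_tower Phi_rho E) w)) (IG (Phi_pi u w)).
Proof.
move=> a; elim/dsum_ind: a => [|n a]; first by lin_closed_eq.
case: (eqVneq n 0) => [n0|n0].
  move: a; rewrite n0 => a; rewrite -/(inG _ a) (af_GG BLP) Phi_piP pi_G_base.
  by rewrite (ep_base pairP).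
(* An element of nonzero degree moves [u] out of degree 0, so both sides vanish. *)
rewrite (af_zero BLP) ?addr0// pair_component_l (pe_graded pi_posP).
  by rewrite /incU inc0 linear0l.
by rewrite addr0 eq_sym.
Qed.

Lemma represents_0 u w : u = 0 \/ w = 0 -> represents u w 0.
Proof.
by case=> -> a; rewrite ?linear0r ?linear0l.
Qed.

Lemma represents_exists u w : exists t, represents u w t.
Proof.
(* [w] stays general, since representing (x.u, w) requires elements for both (u, w) and (u, x.w). *)
elim/Upos_ind: u w => [|u w|n x u IH w].
- apply: lin_closed_forall => w; split=> [|c u u' [t ut] [t' ut']].
    by exists 0; apply: represents_0; left.
  by exists (c *: t + t'); apply: represents_linear_l.
- elim/Uneg_ind: w => [|w|n y w [t ut]].
  + split=> [|c w w' [t ut] [t' ut']].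
      by exists 0; apply: represents_0; right.
    by exists (c *: t + t'); apply: represents_linear_r.
  + rewrite (layer_base_val u) (layer_base_val w).
    by eexists; apply: represents_base.
  (* The subtracted 0 represents (y.u, w), as y kills [u] of degree 0. *)
  + exists (br (Y y) t - 0); rewrite -(ne_Y varpi_negP).
    apply: represents_act_r => //; apply: represents_0.
    by left; rewrite (pe_Y0 pi_posP).
- have [t ut] := IH w; have [t' ut'] := IH (varpi_neg (X x) w).
  by exists (br (X x) t - t'); rewrite -(pe_X pi_posP); apply: represents_act_l.
Qed.

Lemma Phi_L_exists :
  exists Phi_L : {bilinear Upos Phi_rho E -> Uneg Phi_rho E -> L Phi_rho},
    forall u w, represents u w (Phi_L u w).
Proof.
pose phi u w := projT1 (cid (represents_exists u w)).
(* Representing elements are chosen pointwise; their uniqueness makes the choice bilinear. *)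
have phiP u w : represents u w (phi u w) by exact: projT2 (cid _).
have phi_bilinear : bilinear_for *:%R *:%R phi.
  split=> [w c u u'|u c w w']; apply: represents_unique (phiP _ _) _.
    exact: represents_linear_l.
  exact: represents_linear_r.
by exists (bilinear_pack phi_bilinear).
Qed.

(** * Equivariance, grading and recursion of the Phi-map *)

Section PhiMap.
Context (Phi_L : {bilinear Upos Phi_rho E -> Uneg Phi_rho E -> L Phi_rho}).
Context (Phi_LP : forall u w, represents u w (Phi_L u w)).

Lemma Phi_L_act z u w :
  Phi_L (pi_pos z u) w = br z (Phi_L u w) - Phi_L u (varpi_neg z w).
Proof. by apply: represents_unique (Phi_LP _ _) _; apply: represents_act_l. Qed.

Lemma Phi_L_base u w :
  Phi_L (incU (@layer_base _ _ (ext_pos_tower Phi_rho E) u))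
    (incUU (@layer_base _ _ (ext_neg_tower Phi_rho E) w)) = IG (Phi_pi u w).
Proof. exact: represents_unique (Phi_LP _ _) (represents_base _ _). Qed.

Lemma Phi_L_pos x u (w : layer (ext_neg_tower Phi_rho E) 0) :
  Phi_L (pi_pos (X x) u) (incUU w) = br (X x) (Phi_L u (incUU w)).
Proof. by rewrite Phi_L_act (ne_X0 varpi_negP) linear0r subr0. Qed.

Lemma Phi_L_neg y u w :
  Phi_L u (varpi_neg (Y y) w) = br (Y y) (Phi_L u w) - Phi_L (pi_pos (Y y) u) w.
Proof. by rewrite Phi_L_act opprB addrC subrK. Qed.

Lemma BL_component n (z : Lpiece Phi_rho (- n)) t :
  BL (inc z) t = BL (inc z) (inc (component t n)).
Proof.
elim/dsum_ind: t => [|m t].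
  split=> [|c t t']; first by rewrite inc0.
  by rewrite component_linear inc_linear !linearPr/= => -> ->.
case: (eqVneq m n) => [mn|mn].
  by case: n / mn z => z; rewrite component_inc.
rewrite (af_zero BLP) ?component_inc_neq// ?inc0 ?linear0r//.
by rewrite addrC subr_eq0.
Qed.

(** The degree n component is tested by B_L against V_{-n} only, which sends [u] to degree i - n.
    For n different from i - j this is not j, so the result is orthogonal to [w] and the component
    is zero. *)
Lemma Phi_L_homogeneous i j (u : Upos_piece Phi_rho E i)
    (w : Uneg_piece Phi_rho E j) :
  Phi_L (incU u) (incUU w) =
  inc (component (Phi_L (incU u) (incUU w)) (Posz i - Posz j)).
Proof.
apply: dsum_homogeneous => n nij.
rewrite -[LHS](@component_inc _ _ (Lpiece Phi_rho)).
suff -> : inc (component (Phi_L (incU u) (incUU w)) n) = 0 :> L Phi_rho by [].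
have [_] := af_nondegenerate BLP; apply=> a.
elim/dsum_ind: a => [|m a]; first by lin_closed_eq.
case: (eqVneq m (- n)) => [mn|mn]; last first.
  by rewrite (af_zero BLP)// addr_eq0.
move: a; rewrite mn => a; rewrite -BL_component Phi_LP pair_component_l.
rewrite (pe_graded pi_posP); first by rewrite /incU inc0 linear0l.
by apply: contraNneq nij => ->; rewrite opprD opprK addrCA subrr addr0.
Qed.

Lemma Phi_tilde_exists :
  exists F : Phi_tilde_family Phi_rho E, Phi_tilde Phi_pi br pi_pos F.
Proof.
have bil i j : bilinear_for *:%R *:%R
    (fun (u : Upos_piece Phi_rho E i) (w : Uneg_piece Phi_rho E j) =>
       component (Phi_L (incU u) (incUU w)) (Posz i - Posz j)).
  split=> [w c u u'|u c w w'].
    by rewrite /incU inc_linear linearPl/= component_linear.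
  by rewrite /incUU inc_linear linearPr/= component_linear.
(* Taking components of [Phi_L] yields a well-defined family at once; by homogeneity its recursion
   is that of [Phi_L]. *)
exists (fun i j => bilinear_pack (bil i j)); split=> [u w|i x u w|j y u w|i j y u w] /=;
  rewrite -!Phi_L_homogeneous.
- exact: Phi_L_base.
- by rewrite -(pe_X pi_posP) Phi_L_pos.
- by rewrite -(ne_Y varpi_negP) Phi_L_neg (pe_Y0 pi_posP) linear0l subr0.
- by rewrite -(ne_Y varpi_negP) Phi_L_neg -pi_Y_homogeneous.
Qed.

(** Raised elements span each layer, so the recursion determines the family. The outer induction is
    on j with i general, because degree (i + 1, j + 1) refers to both (i + 1, j) and (i, j); for j =
    0 the induction is on i. *)
Lemma Phi_tilde_unique (F : Phi_tilde_family Phi_rho E) :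
  Phi_tilde Phi_pi br pi_pos F ->
  forall i j (u : Upos_piece Phi_rho E i) (w : Uneg_piece Phi_rho E j),
  Phi_L (incU u) (incUU w) = inc (F i j u w).
Proof.
move=> FP i j; elim: j i => [|j IHj] i u w.
  elim: i u => [|i IHi] u.
    by rewrite (layer_base_val u) (layer_base_val w) Phi_L_base (pt_00 FP).
  move: u; apply: layer_ind.
    split=> [|c u u']; first by rewrite linear0l /incU !inc0 linear0l.
    by rewrite /incU inc_linear !linearPl/= inc_linear => -> ->.
  move=> x u; have := pt_pos FP x u w.
  by rewrite -IHi -Phi_L_pos (pe_X pi_posP).
move: w; apply: layer_ind.
  split=> [|c w w']; first by rewrite linear0r /incUU !inc0 linear0r.
  by rewrite /incUU inc_linear !linearPr/= inc_linear => -> ->.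
move=> y w; rewrite -/(rneg y w) -(ne_Y varpi_negP) Phi_L_neg.
case: i u => [|i] u.
  by rewrite (pt_neg0 FP) (pe_Y0 pi_posP) linear0l subr0 IHj.
(* y.u is rewritten as the inclusion of its degree i component so that the hypothesis applies to
   it. *)
by rewrite (pt_neg FP) pi_Y_homogeneous !IHj -pi_Y_homogeneous.
Qed.

End PhiMap.
End Extension.

(** * The extended pentad and its Phi-map *)

Unset Implicit Arguments.

Theorem theorem3p25 (k : fieldType) (G : lie_data k)
    (D E : paired_modules G)
    (Phi_rho : {bilinear modV D -> modVV D -> G})
    (Phi_pi : {bilinear modV E -> modVV E -> G})
    (pentad_rho : standard_pentad D) (pentad_pi : standard_pentad E)
    (Phi_rhoP : Phi_map Phi_rho) (Phi_piP : Phi_map Phi_pi)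
    (B0_symmetric : sym_form (B0 G))
    (br : {bilinear L Phi_rho -> L Phi_rho -> L Phi_rho})
    (brP : assoc_bracket br)
    (BL : {biscalar L Phi_rho}) (BLP : assoc_form br BL)
    (pi_pos : {bilinear L Phi_rho -> Upos Phi_rho E -> Upos Phi_rho E})
    (pi_posP : positive_extension br pi_pos)
    (varpi_neg : {bilinear L Phi_rho -> Uneg Phi_rho E -> Uneg Phi_rho E})
    (varpi_negP : negative_extension br varpi_neg)
    (pair : {bilinear Upos Phi_rho E -> Uneg Phi_rho E -> k | *%R & *%R})
    (pairP : extension_pairing pi_pos pair) :
  let LG := LieData br BL in
  let LD := @PairedModules k LG _ pi_pos _ varpi_neg pair in
  standard_pentad LD /\
  (exists F : Phi_tilde_family Phi_rho E, Phi_tilde Phi_pi br pi_pos F) /\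
  (forall (Phi_L : {bilinear Upos Phi_rho E -> Uneg Phi_rho E -> L Phi_rho})
      (F : Phi_tilde_family Phi_rho E),
    @Phi_map k LG LD Phi_L -> Phi_tilde Phi_pi br pi_pos F ->
    forall (i j : nat) (u : Upos_piece Phi_rho E i)
        (w : Uneg_piece Phi_rho E j),
      Phi_L (incU u) (incUU w) = inc (F i j u w)).
Proof.
have [Phi_L Phi_LP] := Phi_L_exists brP pi_posP varpi_negP pairP pentad_pi BLP Phi_piP.
split; [|split].
- split=> /=.
  + exact: ab_lie brP.
  (* A nonzero element of g stays nonzero in L, being recovered as the degree 0 component. *)
  + have [a a0] := sp_nonzero pentad_pi; exists (inG _ a).
    apply: contra_neq a0 => ia0.
    by rewrite -(@component_inc _ _ (Lpiece Phi_rho) (Posz 0) a) -/(inG _ a) ia0.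
  + exact: af_invariant BLP.
  + exact: af_nondegenerate BLP.
  + exact: pe_rep pi_posP.
  + exact: ne_rep varpi_negP.
  + exact (pair_invariant brP pi_posP varpi_negP pairP pentad_pi).
  + exact (pair_nondegenerate brP pi_posP varpi_negP pairP pentad_pi).
  + by exists Phi_L => a u w; exact: Phi_LP.
- exact (Phi_tilde_exists brP pi_posP varpi_negP pairP pentad_pi BLP Phi_piP Phi_LP).
(* Being a Phi-map of the new pentad unfolds to [represents] at every pair, so the comparison
   applies to an arbitrary [Phi]. *)
- move=> Phi F PhiP FP.
  refine (Phi_tilde_unique brP pi_posP varpi_negP pairP pentad_pi BLP Phi_piP _ FP).
  by move=> u w a; exact: PhiP.
Qed.
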